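(* Let $\mathcal{B}$ be an M-basis in $\mathbb{X}$ and let $\tau\in(0,1]$. Then for every $m\in\mathbb{N}$, $$\max\left\{k^c_m,\ \widetilde{\mathbf L}_{m,\tau},\ \frac{\nu_{m,\tau}}{\tau}\right\}\ \le\ \mathbf L_{m,\tau}\ \le\ \frac{k_{2m-1}^c\,\nu_{m,\tau}}{\tau}.$$
   Context: Setting. $(\mathbb{X},\|\cdot\|)$ is an infinite-dimensional Banach space over $\mathbb{F}=\mathbb{R}$ or $\mathbb{C}$ with dual $(\mathbb{X}^*,\|\cdot\|_* )$. A (semi-normalized Markushevich) M-basis is a sequence $\mathcal{B}=(e_n)_{n=1}^\infty$ in $\mathbb{X}$ such that: (1) there is a unique collection $(e_n^* )_{n=1}^\infty\subset\mathbb{X}^*$ with $e_i^*(e_j)=\delta_{i,j}$; (2) $0<\inf_n\{\|e_n\|,\|e_n^*\|_*\}\le\sup_n\{\|e_n\|,\|e_n^*\|_*\}<\infty$; (3) $\mathbb{X}=\overline{\mathrm{span}\{e_n:n\in\mathbb{N}\}}$; (4) $\mathbb{X}^*=\overline{\mathrm{span}\{e_n^*:n\in\mathbb{N}\}}^{w^*}$. Notation. $\mathrm{supp}(x)=\{n:e_n^*(x)\ne0\}$, $\|x\|_\infty=\sup_n|e_n^*(x)|$, and $P_A(x)=\sum_{n\in A}e_n^*(x)e_n$ for finite $A\subset\mathbb{N}$. A sign is a sequence $\varepsilon=(\varepsilon_n)\subset\mathbb{F}$ with $|\varepsilon_n|=1$, and $1_{\varepsilon A}=\sum_{n\in A}\varepsilon_ne_n$.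 $A\sqcup B\sqcup x$ means that $A$, $B$, $\mathrm{supp}(x)$ are pairwise disjoint. Weak greedy sets. A finite $\Lambda\subset\mathbb{N}$ is a $\tau$-weak greedy set of $x$ if $\min_{n\in\Lambda}|e_n^*(x)|\ge\tau\max_{n\notin\Lambda}|e_n^*(x)|$ (the empty set is always allowed). $\mathcal{G}(x,m,\tau)$ is the collection of all $\tau$-weak greedy sets of $x$ of cardinality $m$, and $\gamma_{m,\tau}(x)=\sup\{\|x-P_\Lambda(x)\|:\Lambda\in\mathcal{G}(x,m,\tau)\}$. Lebesgue parameters. $\sigma_m(x)=\inf\{\|x-\sum_{n\in A}a_ne_n\|: A\subset\mathbb{N},|A|\le m,(a_n)\subset\mathbb{F}\}$ and $\widetilde\sigma_m(x)=\inf\{\|x-P_A(x)\|:A\subset\mathbb{N},|A|=m\}$. $\mathbf L_{m,\tau}$ (resp. $\widetilde{\mathbf L}_{m,\tau}$) is the smallest constant such that $\gamma_{m,\tau}(x)\le\mathbf L_{m,\tau}\sigma_m(x)$ (resp. $\gamma_{m,\tau}(x)\le\widetilde{\mathbf L}_{m,\tau}\widetilde\sigma_m(x)$) for all $x\in\mathbb{X}$. Constants. $k_m^c=\sup_{|A|\le m}\|I-P_A\|$ (operator norm, $A\subset\mathbb{N}$). The (A,$\tau$)-property constant is $$\nu_{m,\tau}=\sup\left\{\frac{\|\tau x+1_{\delta B}\|}{\|x+1_{\varepsilon A}\|}: x\in\mathbb{X},\ \|x\|_\infty\le 1/\tau,\ A,B\subset\mathbb{N},\ |A|=|B|\le m,\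 A\sqcup B\sqcup x,\ (\varepsilon),(\delta)\text{ signs}\right\},$$ where only quotients with nonzero denominator are considered. *)

(* Defs.v *)
From mathcomp Require Import all_boot all_order all_algebra finmap complex.
From mathcomp Require Import all_classical all_reals.
From mathcomp Require Import ereal topology normedtype sequences.

Set Implicit Arguments.
Unset Strict Implicit.
Unset Printing Implicit Defensive.

Import Order.TTheory GRing.Theory Num.Theory.
Import numFieldNormedType.Exports.

Local Open Scope classical_set_scope.
Local Open Scope ring_scope.

Variant scalars := RealScalars | ComplexScalars.

Definition scalar_field (R : realType) (s : scalars) : numFieldType :=
  match s with RealScalars => R | ComplexScalars => R[i] end.

Definition to_real (R : realType) (s : scalars) : scalar_field R s -> R :=
  match s return scalar_field R s -> R with
  | RealScalars => id
  | ComplexScalars => @complex.Re R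
  end.

Definition of_real (R : realType) (s : scalars) : R -> scalar_field R s :=
  match s return R -> scalar_field R s with
  | RealScalars => id
  | ComplexScalars => @real_complex R
  end.
Arguments of_real {R s}.

(* The library norm of a normed space over K takes its values in K; see
   [of_real_rnorm] for the fact that [to_real] loses nothing. *)
Definition rnorm (R : realType) (s : scalars)
    (V : normedModType (scalar_field R s)) (x : V) : R :=
  to_real `|x|.

Lemma of_real_rnorm (R : realType) (s : scalars)
    (V : normedModType (scalar_field R s)) (x : V) :
  of_real (rnorm x) = `|x|.
Proof.
rewrite /rnorm; have := normr_ge0 x; move: `|x|.
by case: s {V x} => //= -[a b]; rewrite lecE /= => /andP[/eqP -> _].
Qed.

Section BanachSpace.
Variables (R : realType) (s : scalars).
Local Notation K := (scalar_field R s).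
Variable X : completeNormedModType K.

Definition infinite_dimensional : Prop :=
  ~ exists (n : nat) (v : 'I_n -> X),
      forall x, exists a : 'I_n -> K, x = \sum_i a i *: v i.

Definition opnorm (V W : normedModType K) (T : V -> W) : \bar R :=
  ereal_sup [set (rnorm (T x))%:E | x in [set x | rnorm x <= 1]].

Definition dual : set (X -> K^o) := [set f | linear f /\ continuous f].

Definition lin_span (V : lmodType K) (v : nat -> V) : set V :=
  [set x | exists (A : {fset nat}) (a : nat -> K),
             x = \sum_(n <- A) a n *: v n].

Definition biorthogonal (e : nat -> X) (es : nat -> X -> K^o) : Prop :=
  (forall n, dual (es n)) /\ (forall i j, es i (e j) = (i == j)%:R).

(* The weak* topology of the dual is the one induced by the topology of
   pointwise convergence on all functions from X to K. *)
Definition Mbasis (e : nat -> X) (es : nat -> X -> K^o) : Prop :=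
  let norms := [set (rnorm (e n))%:E | n in setT]
           `|` [set opnorm (es n) | n in setT] in
  [/\ biorthogonal e es /\ (forall fs, biorthogonal e fs -> fs = es),
      (0 < ereal_inf norms)%E /\ (ereal_sup norms < +oo)%E,
      closure (lin_span e) = setT
    & dual `<=` closure (lin_span es : set {ptws X -> K^o}) ].

End BanachSpace.

Section GreedyConstants.
Variables (R : realType) (s : scalars).
Local Notation K := (scalar_field R s).
Variables (X : completeNormedModType K) (e : nat -> X) (es : nat -> X -> K^o).
Implicit Types (x : X) (A B L : {fset nat}) (m : nat) (tau : R).

Definition supp x : set nat := [set n | es n x != 0].

Definition norm_infty x : \bar R :=
  ereal_sup [set (rnorm (es n x))%:E | n in setT].

Definition coord_proj A x : X := \sum_(n <- A) es n x *: e n.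

Definition sign (eps : nat -> K) : Prop := forall n, `|eps n| = 1.

Definition signed_sum (eps : nat -> K) A : X := \sum_(n <- A) eps n *: e n.

Definition disjoint3 A B x : Prop :=
  [/\ [set` A] `&` [set` B] = set0, [set` A] `&` supp x = set0
    & [set` B] `&` supp x = set0].

(* The supremum is a maximum, because the coefficients of a vector tend to 0
   along an M-basis. The infimum over the empty set is +oo, so that the empty
   set is always weak greedy. *)
Definition weak_greedy tau x L : Prop :=
  (tau%:E * ereal_sup [set (rnorm (es n x))%:E | n in ~` [set` L]]
   <= ereal_inf [set (rnorm (es n x))%:E | n in [set` L]])%E.

Definition greedy_sets x m tau : set {fset nat} :=
  [set L | #|` L| = m /\ weak_greedy tau x L].

Definition gamma m tau x : \bar R :=
  ereal_sup [set (rnorm (x - coord_proj L x))%:E | L in greedy_sets x m tau].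

Definition sigma m x : \bar R :=
  ereal_inf [set z | exists (A : {fset nat}) (a : nat -> K),
    (#|` A| <= m)%N /\ z = (rnorm (x - \sum_(n <- A) a n *: e n))%:E].

Definition sigma_tilde m x : \bar R :=
  ereal_inf [set (rnorm (x - coord_proj A x))%:E | A in [set A | #|` A| = m]].

(* The smallest C such that f <= C * g pointwise, and +oo if there is none *)
Definition least_constant (f g : X -> \bar R) : \bar R :=
  ereal_inf [set C%:E | C in [set C : R | forall x, (f x <= C%:E * g x)%E]].

Definition lebesgue m tau : \bar R := least_constant (gamma m tau) (sigma m).

Definition lebesgue_tilde m tau : \bar R :=
  least_constant (gamma m tau) (sigma_tilde m).

Definition kc m : \bar R :=
  ereal_sup [set opnorm (fun x => x - coord_proj A x) |
             A in [set A : {fset nat} | (#|` A| <= m)%N]].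

Definition nu m tau : \bar R :=
  ereal_sup [set z | exists x A B (eps del : nat -> K),
    [/\ (norm_infty x <= (1 / tau)%:E)%E,
        #|` A| = #|` B| /\ (#|` A| <= m)%N,
        disjoint3 A B x,
        sign eps /\ sign del
      & rnorm (x + signed_sum eps A) != 0 /\
        z = (rnorm (of_real tau *: x + signed_sum del B)
             / rnorm (x + signed_sum eps A))%:E]].

(* When finite, [least_constant] is itself admissible, hence a minimum. *)
Lemma least_constant_attained (f g : X -> \bar R) (C : R) :
  (forall x, 0 <= g x < +oo)%E -> least_constant f g = C%:E ->
  forall x, (f x <= C%:E * g x)%E.
Proof.
move=> g_fin leastE x; have /andP[gx0 gxoo] := g_fin x.
have gx_fin : g x \is a fin_num by rewrite ge0_fin_numE.
apply/lee_addgt0Pr => d d0.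
set r := fine (g x); have r0 : 0 <= r by exact: fine_ge0.
have r1 : 0 < r + 1 by rewrite ltr_wpDl.
have : (least_constant f g < (C + d / (r + 1))%:E)%E.
  by rewrite leastE lte_fin ltrDl divr_gt0.
move=> /ereal_inf_lt[_ [D HD <-]]; rewrite lte_fin => DC.
apply: (le_trans (HD x)); rewrite -(fineK gx_fin) -/r -!EFinM -EFinD lee_fin.
apply: (@le_trans _ _ ((C + d / (r + 1)) * r)).
  by rewrite ler_wpM2r // ltW.
rewrite mulrDl lerD2l mulrAC ler_pdivrMr // ler_pM2l // lerDl //.
Qed.

End GreedyConstants.

(* Main.v *)
(** Lower bounds. Coefficients tend to 0, so any finite set can be completed to
    cardinality m by far away indices D with P_D x negligible. Adding large
    coefficients on such a completion of A makes it greedy, which gives the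
    bound for k^c_m. For nu, the vector x + 1_(eps A) + tau^-1 1_(del B) + t 1_D
    has weak greedy set A u D, while removing B u D leaves x + 1_(eps A).

    Upper bound. For z = x - sum_A a_n e_n, write x' = x - P_(A u L) x and
    B = A \ L, and choose A1 inside L \ A with #A1 = #B. Let t be the least
    modulus of a coefficient of x on A1. By convexity, x - P_L x = x' + P_B x is
    dominated by the vectors x' + (t/tau) 1_(del B), the A-property replaces
    these by x' + t 1_(eps A1), and by convexity again the latter is dominated
    by vectors x' + P_(A2) x with A2 inside A1, each of which is a projection
    z - P_F z. The index realising t is never truncated, whence #F <= 2m - 1.
    Perturbing x on L removes the case t = 0. *)

Require Import Defs.
From mathcomp Require Import all_boot all_order all_algebra finmap complex.
From mathcomp Require Import all_classical all_reals.
From mathcomp Require Import ereal topology normedtype sequences.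
From mathcomp Require Import ring lra zify.
Set Implicit Arguments.
Unset Strict Implicit.
Unset Printing Implicit Defensive.

Import Order.TTheory GRing.Theory Num.Theory.
Import numFieldNormedType.Exports.
Local Open Scope ring_scope.

(** * Real-valued norms over either scalar field, and a convexity principle *)

Section Norm.
Context {R : realType} {s : scalars}.
Local Notation K := (scalar_field R s).

Lemma of_realD (a b : R) : of_real (a + b) = of_real a + of_real b :> K.
Proof. by case: s => //=; rewrite rmorphD. Qed.

Lemma of_realM (a b : R) : of_real (a * b) = of_real a * of_real b :> K.
Proof. by case: s => //=; rewrite rmorphM. Qed.

Lemma of_real0 : of_real 0 = 0 :> K.
Proof. by case: s => //=; rewrite rmorph0. Qed.

Lemma of_real1 : of_real 1 = 1 :> K.
Proof. by case: s => //=; rewrite rmorph1. Qed.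

Lemma of_realN (a : R) : of_real (- a) = - of_real a :> K.
Proof. by case: s => //=; rewrite rmorphN. Qed.

Lemma ler_of_real (a b : R) : (of_real a <= of_real b :> K) = (a <= b).
Proof. by case: s => //=; rewrite lecR. Qed.

Lemma ltr_of_real (a b : R) : (of_real a < of_real b :> K) = (a < b).
Proof. by case: s => //=; rewrite ltcR. Qed.

Lemma of_real_inj : injective (@of_real R s).
Proof. by move=> a b ab; apply/le_anti; rewrite -!ler_of_real ab lexx. Qed.

Context {V : normedModType K}.
Implicit Types (x y : V) (a : K).

Lemma rnorm_ge0 x : 0 <= rnorm x.
Proof. by rewrite -(@ler_of_real) of_real0 of_real_rnorm. Qed.

Lemma rnorm0 : rnorm (0 : V) = 0.
Proof. by apply: of_real_inj; rewrite of_real_rnorm normr0 of_real0. Qed.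

Lemma rnorm_eq0 x : (rnorm x == 0) = (x == 0).
Proof.
apply/eqP/eqP => [x0|->]; last exact: rnorm0.
by apply/eqP; rewrite -normr_eq0 -of_real_rnorm x0 of_real0.
Qed.

Lemma rnormN x : rnorm (- x) = rnorm x.
Proof. by rewrite /rnorm normrN. Qed.

Lemma rnormD x y : rnorm (x + y) <= rnorm x + rnorm y.
Proof. by rewrite -ler_of_real of_realD !of_real_rnorm ler_normD. Qed.

Lemma rnormZ a x : rnorm (a *: x) = rnorm (a : K^o) * rnorm x.
Proof. by apply: of_real_inj; rewrite of_realM !of_real_rnorm normrZ. Qed.

Lemma rnorm_of_real (r : R) : rnorm (of_real r : K^o) = `|r|.
Proof.
apply: of_real_inj; rewrite of_real_rnorm.
have [r0|r0] := leP 0 r.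
  by rewrite (ger0_norm r0) ger0_norm // -of_real0 ler_of_real.
by rewrite (ltr0_norm r0) ltr0_norm ?of_realN // -of_real0 ltr_of_real.
Qed.

Lemma rnormZr (r : R) x : rnorm (of_real r *: x) = `|r| * rnorm x.
Proof. by rewrite rnormZ rnorm_of_real. Qed.

Lemma rnormM a b : rnorm (a * b : K^o) = rnorm (a : K^o) * rnorm (b : K^o).
Proof. by apply: of_real_inj; rewrite of_realM !of_real_rnorm normrM. Qed.

Lemma rnorm1 : rnorm (1 : K^o) = 1.
Proof. by rewrite -of_real1 rnorm_of_real normr1. Qed.

Lemma rnorm_sum (I : Type) (l : seq I) (v : I -> V) :
  rnorm (\sum_(i <- l) v i) <= \sum_(i <- l) rnorm (v i).
Proof.
elim/big_rec2: _ => [|i y1 y2 _ IH]; first by rewrite rnorm0.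
by apply: (le_trans (rnormD _ _)); rewrite lerD2l.
Qed.

Lemma closure_rnorm (A : set V) x (d : R) : closure A x -> 0 < d ->
  exists2 y, A y & rnorm (x - y) < d.
Proof.
move=> Ax d0; have d0' : 0 < of_real d :> K by rewrite -of_real0 ltr_of_real.
have [y [Ay]] := Ax _ (nbhsx_ballx x _ d0'); rewrite -ball_normE /= => xy.
by exists y => //; rewrite -ltr_of_real of_real_rnorm.
Qed.

(** The value 1 at 0 makes [sgn] unimodular everywhere, so that [sgn \o c] is a sign for every
    [c]. *)
Definition sgn (a : K) : K := if a == 0 then 1 else a / `|a|.

Lemma norm_sgn a : `|sgn a| = 1.
Proof.
rewrite /sgn; case: eqP => [_|/eqP a0]; first exact: normr1.
by rewrite normrM normfV normr_id mulfV ?normr_eq0.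
Qed.

Lemma rnorm_sign (eps : nat -> K) n : sign eps -> rnorm (eps n : K^o) = 1.
Proof. by move=> h; apply: of_real_inj; rewrite of_real_rnorm h of_real1. Qed.

Lemma sgnE a : a = of_real (rnorm (a : K^o)) * sgn a.
Proof.
rewrite of_real_rnorm /sgn; case: eqP => [->|/eqP a0].
  by rewrite normr0 mul0r.
by rewrite mulrCA mulfV ?mulr1 // normr_eq0.
Qed.

(* The vector is affine in each weight r n, so its norm is largest at a vertex. *)
Lemma convex_choice (l : seq nat) (r : nat -> R) (p q : nat -> V) u (N : R) :
  uniq l -> (forall n, n \in l -> 0 <= r n <= 1) ->
  (forall b : nat -> bool,
    rnorm (u + \sum_(n <- l) (if b n then p n else q n)) <= N) ->
  rnorm (u + \sum_(n <- l)
    (of_real (r n) *: p n + of_real (1 - r n) *: q n)) <= N.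
Proof.
elim: l u => [|k l IH] u /=; first by move=> _ _ /(_ xpredT); rewrite !big_nil.
case/andP=> kl ul r01 Hb; rewrite big_cons.
have /andP[rk0 rk1] := r01 k (mem_head _ _).
have rl n : n \in l -> 0 <= r n <= 1 by move=> nl; rewrite r01 // inE nl orbT.
set S := \sum_(n <- l) _.
have Hc c : rnorm ((u + if c then p k else q k) + S) <= N.
  apply: (IH) => // b.
  (* A vertex [b] on [l] is extended by the choice [c] at [k]; since [k] is not in [l], the sum over
     [l] is unaffected. *)
  have := Hb (fun n => if n == k then c else b n).
  rewrite big_cons eqxx addrA.
  suff -> : \sum_(n <- l) (if if n == k then c else b n then p n else q n)
     = \sum_(n <- l) (if b n then p n else q n) by [].
  apply: eq_big_seq => n nl; case: eqP => // nk.
  by rewrite -nk nl in kl.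
have -> : u + (of_real (r k) *: p k + of_real (1 - r k) *: q k + S) =
  of_real (r k) *: (u + p k + S) + of_real (1 - r k) *: (u + q k + S).
  have split1 (v : V) : v = of_real (r k) *: v + of_real (1 - r k) *: v.
    by rewrite -scalerDl -of_realD subrKC of_real1 scale1r.
  rewrite {1}(split1 u) {1}(split1 S) !scalerDr.
  by rewrite (AC (2*(2*2)) ((1*3*5)*(2*4*6))).
apply: (le_trans (rnormD _ _)); rewrite !rnormZr !ger0_norm ?subr_ge0//.
apply: (@le_trans _ _ (r k * N + (1 - r k) * N)).
  by rewrite lerD // ler_wpM2l ?subr_ge0 //; [exact: (Hc true)|exact: (Hc false)].
by rewrite -mulrDl subrKC mul1r.
Qed.

End Norm.

(** * Finite index sets *)

Section FiniteSets.

Lemma big_fsetU_disjoint {V : zmodType} (A B : {fset nat}) (f : nat -> V) :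
  [disjoint A & B]%fset ->
  \sum_(n <- (A `|` B)%fset) f n = \sum_(n <- A) f n + \sum_(n <- B) f n.
Proof.
move=> /fdisjointP AB; rewrite (big_fsetID _ (mem A)) /=; congr (_ + _).
  by apply: eq_fbigl => n; rewrite !inE /=; case: (n \in A); rewrite ?andbF.
apply: eq_fbigl => n; rewrite !inE /=; have := AB n.
by case: (n \in A); case: (n \in B) => // /(_ isT).
Qed.

Lemma fset_bounded (F : {fset nat}) : exists N, forall n, n \in F -> (n < N)%N.
Proof.
exists (\max_(n <- F) n.+1) => n nF.
by rewrite (big_fsetD1 n) //= leq_max leqnn.
Qed.

Lemma fsubset_of_card (A : {fset nat}) (k : nat) : (k <= #|` A|)%N ->
  exists2 B : {fset nat}, (B `<=` A)%fset & #|` B| = k.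
Proof.
move=> kA; exists [fset n in take k A]%fset.
  by apply/fsubsetP => n; rewrite !inE => /mem_take.
by rewrite card_fseq undup_id ?take_uniq ?fset_uniq // size_takel.
Qed.

Lemma mem_interval (N k n : nat) :
  (n \in [fset i in iota N k]%fset) = (N <= n < N + k)%N.
Proof. by rewrite !inE mem_iota. Qed.

Lemma fdisjoint_interval (F : {fset nat}) (N k : nat) :
  (forall n, n \in F -> (n < N)%N) ->
  [disjoint [fset n in iota N k]%fset & F]%fset.
Proof.
move=> FN; apply/fdisjointP => n; rewrite mem_interval => /andP[Nn _].
by apply/negP => /FN; rewrite ltnNge Nn.
Qed.

Lemma card_interval (N k : nat) : #|` [fset n in iota N k]%fset| = k.
Proof. by rewrite card_fseq undup_id ?iota_uniq // size_iota. Qed.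

End FiniteSets.

(** * Coordinate functionals and projections; decay of coefficients *)

Section Biorthogonal.
Context {R : realType} {s : scalars}.
Local Notation K := (scalar_field R s).
Context {X : completeNormedModType K} {e : nat -> X} {es : nat -> X -> K^o}.
Context (es_linear : forall n, linear (es n)).
Context (es_e : forall i j, es i (e j) = (i == j)%:R).
Implicit Types (x y : X) (A B D F : {fset nat}) (a : nat -> K).
Local Notation P := (coord_proj e es).

Lemma es0 n : es n 0 = 0.
Proof.
have := es_linear n 1 0 0; rewrite !scale1r addr0 => /eqP.
by rewrite -subr_eq0 opprD addNKr oppr_eq0 => /eqP.
Qed.

Lemma esZ n (c : K) x : es n (c *: x) = c * es n x.
Proof. by have := es_linear n c x 0; rewrite !addr0 es0 addr0. Qed.

Lemma esD n x y : es n (x + y) = es n x + es n y.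
Proof. by have := es_linear n 1 x y; rewrite !scale1r. Qed.

Lemma esB n x y : es n (x - y) = es n x - es n y.
Proof. by rewrite esD -scaleN1r esZ mulN1r. Qed.

Lemma es_comb A a k :
  es k (\sum_(n <- A) a n *: e n) = if k \in A then a k else 0.
Proof.
have -> : es k (\sum_(n <- A) a n *: e n) = \sum_(n <- A) a n * (k == n)%:R.
  elim/big_rec2: _ => [|n y1 y2 _ <-]; first exact: es0.
  by rewrite esD esZ es_e.
case: ifPn => kA.
  rewrite (big_fsetD1 k) //= eqxx mulr1 big_seq big1 ?addr0 // => n.
  by rewrite !inE eq_sym => /andP[/negPf -> _]; rewrite mulr0.
rewrite big_seq big1 // => n nA.
by case: eqP => [kn|_]; [rewrite -kn (negPf kA) in nA|rewrite mulr0].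
Qed.

Lemma coord_projD A x y : P A (x + y) = P A x + P A y.
Proof.
by rewrite /coord_proj -big_split /=; apply: eq_bigr => n _; rewrite esD scalerDl.
Qed.

Lemma coord_projZ A (c : K) x : P A (c *: x) = c *: P A x.
Proof.
by rewrite /coord_proj scaler_sumr; apply: eq_bigr => n _; rewrite esZ scalerA.
Qed.

Lemma coord_projB A x y : P A (x - y) = P A x - P A y.
Proof. by rewrite coord_projD -scaleN1r coord_projZ scaleN1r. Qed.

Lemma coord_projU A B x : [disjoint A & B]%fset ->
  P (A `|` B)%fset x = P A x + P B x.
Proof. exact: big_fsetU_disjoint. Qed.

Lemma es_coord_proj A x k : es k (P A x) = if k \in A then es k x else 0.
Proof. exact: es_comb. Qed.

Lemma coord_proj_comb A F a : (A `<=` F)%fset ->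
  P F (\sum_(n <- A) a n *: e n) = \sum_(n <- A) a n *: e n.
Proof.
move=> AF; rewrite /coord_proj -(big_fset_incl _ AF).
  by apply: eq_big_seq => n nA; rewrite es_comb nA.
by move=> n _ nA; rewrite es_comb (negPf nA) scale0r.
Qed.

Context {M : R} (M_gt0 : 0 < M).
Context (e_le : forall n, rnorm (e n) <= M).
Context (es_le : forall n x, rnorm (es n x) <= M * rnorm x).
Context (e_dense : closure (lin_span e) = setT).

(** By density, [x] is within [d / M] of a finite combination. Off the support of that combination,
    the coefficients of [x] are those of the difference, and the coordinate functionals have norm at
    most [M]. *)
Lemma coord_small x (d : R) : 0 < d ->
  exists F, forall n, n \notin F -> rnorm (es n x) < d.
Proof.
move=> d0; have dM : 0 < d / M by rewrite divr_gt0.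
have xcl : closure (lin_span e) x by rewrite e_dense.
have [y [A [a yE]] xy] := closure_rnorm xcl dM.
exists A => n nA; rewrite -[x](subrK y) esD yE es_comb (negPf nA) addr0 -yE.
by apply: (le_lt_trans (es_le _ _)); rewrite mulrC -ltr_pdivlMr.
Qed.

Lemma coord_proj_far F x k (d : R) : 0 < d ->
  exists D, [/\ #|` D| = k, [disjoint D & F]%fset & rnorm (P D x) < d].
Proof.
(* Each of the [k] terms of [P D x] will have norm at most [d / k.+1]; taking [k.+1] makes the sum
   strictly smaller than [d] and covers [k = 0]. *)
move=> d0; have kM : 0 < k.+1%:R * M by rewrite mulr_gt0.
have [G HG] := coord_small x (divr_gt0 d0 kM).
have [N HN] := fset_bounded (F `|` G)%fset.
pose D := [fset n in iota N k]%fset.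
have DFG : [disjoint D & F `|` G]%fset by apply: fdisjoint_interval.
exists D; split; first exact: card_interval.
  by move: DFG; rewrite fdisjointXU => /andP[].
apply: (@le_lt_trans _ _ (\sum_(n <- D) (d / k.+1%:R))).
  apply: (le_trans (rnorm_sum _ _)); rewrite big_seq [leRHS]big_seq.
  apply: ler_sum => n nD; rewrite rnormZ.
  have /HG/ltW nG : n \notin G.
    by move: DFG; rewrite fdisjointXU => /andP[_ /fdisjointP]; exact.
  apply: (le_trans (ler_pM (rnorm_ge0 _) (rnorm_ge0 _) nG (e_le n))).
  by rewrite invfM mulrA mulfVK ?gt_eqF.
rewrite big_const_seq count_predT iter_addr_0 card_interval.
by rewrite -[ltLHS]mulr_natr mulrAC ltr_pdivrMr // ltr_pM2l // ltr_nat.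
Qed.

End Biorthogonal.

(** * Sign vectors and truncation by convexity *)

Section Convexity.
Context {R : realType} {s : scalars}.
Local Notation K := (scalar_field R s).
Context {X : completeNormedModType K} {e : nat -> X}.
Implicit Types (u : X) (A B : {fset nat}) (c : nat -> K).

(** A scalar of modulus at most [r] lies on the segment between [r] and [-r] times its own sign, so
    [convex_choice] applies and its vertices are sign vectors scaled by [r]. *)
Lemma sign_bound u c (r N : R) B : 0 < r ->
  (forall n, n \in B -> rnorm (c n : K^o) <= r) ->
  (forall del, sign del -> rnorm (u + of_real r *: signed_sum e del B) <= N) ->
  rnorm (u + \sum_(n <- B) c n *: e n) <= N.
Proof.
move=> r0 cr Hdel.
(* The weight solves [w * r - (1 - w) * r = |c n|]. *)
pose w n : R := (1 + rnorm (c n : K^o) / r) / 2.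
pose p n : X := (of_real r * sgn (c n)) *: e n.
have -> : \sum_(n <- B) c n *: e n =
  \sum_(n <- B) (of_real (w n) *: p n + of_real (1 - w n) *: (- p n)).
  apply: eq_big_seq => n nB.
  rewrite scalerN -scalerBl -of_realN -of_realD /p scalerA mulrA -of_realM.
  congr (_ *: _); rewrite [LHS]sgnE; congr (of_real _ * _).
  by rewrite /w; field; rewrite gt_eqF.
apply: convex_choice; first exact: fset_uniq.
  move=> n nB; have := cr n nB; rewrite -[leRHS]mul1r -ler_pdivrMr // => h1.
  have := divr_ge0 (@rnorm_ge0 _ _ K^o (c n)) (ltW r0); rewrite /w; lra.
move=> b; pose del n := if b n then sgn (c n) else - sgn (c n).
have := Hdel del; rewrite /signed_sum scaler_sumr.
have -> : \sum_(n <- B) of_real r *: (del n *: e n) =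
  \sum_(n <- B) (if b n then p n else - p n).
  apply: eq_bigr => n _; rewrite /del /p scalerA.
  by case: (b n); rewrite // mulrN scaleNr.
by apply => n; rewrite /del; case: (b n); rewrite ?normrN norm_sgn.
Qed.

(* The index n0 where the modulus is smallest is never truncated, so the
   convex combination only involves sets containing n0. *)
Lemma truncation_bound u c (N : R) A n0 : n0 \in A -> c n0 != 0 ->
  (forall n, n \in A -> rnorm (c n0 : K^o) <= rnorm (c n : K^o)) ->
  (forall B, (B `<=` A)%fset -> n0 \in B ->
    rnorm (u + \sum_(n <- B) c n *: e n) <= N) ->
  rnorm (u + of_real (rnorm (c n0 : K^o)) *: signed_sum e (sgn \o c) A) <= N.
Proof.
move=> n0A c0 cmin HB; set t := rnorm (c n0 : K^o).
have t0 : 0 < t by rewrite lt_def rnorm_eq0 rnorm_ge0 andbT.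
pose w n : R := t / rnorm (c n : K^o).
(* At [n0] both endpoints are the full term, so every vertex keeps [n0]. The weight there is 1,
   hence the combination is unchanged. *)
pose q n : X := if n == n0 then c n *: e n else 0.
have -> : of_real t *: signed_sum e (sgn \o c) A =
  \sum_(n <- A) (of_real (w n) *: (c n *: e n) + of_real (1 - w n) *: q n).
  rewrite /signed_sum scaler_sumr; apply: eq_big_seq => n nA.
  have cn0 : 0 < rnorm (c n : K^o) by exact: lt_le_trans (cmin n nA).
  have -> : of_real (1 - w n) *: q n = 0.
    rewrite /q; case: eqP => [->|]; last by rewrite scaler0.
    by rewrite /w mulfV ?gt_eqF // subrr of_real0 scale0r.
  rewrite addr0 !scalerA /=; congr (_ *: _).
  by rewrite [in RHS](sgnE (c n)) mulrA -of_realM /w mulfVK ?gt_eqF.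
apply: convex_choice; first exact: fset_uniq.
  move=> n nA; have tn := cmin n nA.
  have cn0 : 0 < rnorm (c n : K^o) by exact: lt_le_trans tn.
  by rewrite /w (divr_ge0 (ltW t0) (ltW cn0)) ler_pdivrMr // mul1r.
move=> b; pose B := [fset n in A | b n || (n == n0)]%fset.
suff -> : \sum_(n <- A) (if b n then c n *: e n else q n) =
          \sum_(n <- B) c n *: e n.
  apply: HB; last by rewrite !inE n0A eqxx orbT.
  by apply/fsubsetP => n; rewrite !inE => /andP[].
rewrite -big_fset_condE /= [RHS]big_mkcond; apply: eq_bigr => n _.
by rewrite /q; case: (b n) => //=; case: eqP.
Qed.

End Convexity.

(** * Real-valued forms of the extended-real definitions *)

Section Constants.
Context {R : realType} {s : scalars}.
Local Notation K := (scalar_field R s).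
Context {X : completeNormedModType K} {e : nat -> X} {es : nat -> X -> K^o}.
Implicit Types (x : X) (A B L : {fset nat}).

Lemma disjoint3P A B x :
  disjoint3 es A B x <-> [/\ [disjoint A & B]%fset,
    forall n, n \in A -> es n x = 0 & forall n, n \in B -> es n x = 0].
Proof.
have supp_disj C : ([set` C] `&` supp es x = set0)%classic <->
    forall n, n \in C -> es n x = 0.
  split=> [/seteqP[CS _] n nC|CS].
    by apply: contrapT => /eqP nx; apply: (CS n).
  by apply/seteqP; split=> // n [/= /CS nx]; rewrite /supp /= nx eqxx.
split=> -[AB /supp_disj HA /supp_disj HB]; split=> //.
  apply/fdisjointP => n nA; apply/negP => nB.
  by move/seteqP: AB => -[+ _]; apply; split; [exact: nA|exact: nB].
apply/seteqP; split=> // n [/= nA nB].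
by move/fdisjointP: AB => /(_ n nA); rewrite nB.
Qed.

Lemma weak_greedyP (tau : R) x L : 0 < tau ->
  weak_greedy es tau x L <-> forall n k, n \in L -> k \notin L ->
    tau * rnorm (es k x) <= rnorm (es n x).
Proof.
move=> tau0; split=> [H n k nL kL|H].
  rewrite -lee_fin EFinM.
  apply: (@le_trans _ _ (tau%:E *
    ereal_sup [set (rnorm (es n x))%:E | n in ~` [set` L]])%E).
    rewrite lee_pmul2l ?lte_fin //; apply: ereal_sup_ubound.
    by exists k => //=; apply/negP.
  by apply: (le_trans H); apply: ereal_inf_lbound; exists n.
apply: le_ereal_inf_tmp => _ [n /= nL <-].
rewrite -[tau]invrK lee_pdivrMl ?invr_gt0 //.
apply: ge_ereal_sup => _ [k /= /negP kL <-].
by rewrite -EFinM lee_fin ler_pdivlMl // H.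
Qed.

Lemma norm_infty_leP x (r : R) :
  (norm_infty es x <= r%:E)%E <-> forall n, rnorm (es n x) <= r.
Proof.
split=> [H n|H].
  by rewrite -lee_fin; apply: le_trans H; apply: ereal_sup_ubound; exists n.
by apply: ge_ereal_sup => _ [n _ <-]; rewrite lee_fin.
Qed.

Lemma opnorm_leP (V W : normedModType K) (T : V -> W) (C : R) :
  (forall (c : K) v, T (c *: v) = c *: T v) ->
  (opnorm T <= C%:E)%E -> forall v, rnorm (T v) <= C * rnorm v.
Proof.
move=> TZ TC v; have [->|v0] := eqVneq v 0.
  by have := TZ 0 0; rewrite !scale0r => ->; rewrite !rnorm0 mulr0.
have rv0 : 0 < rnorm v by rewrite lt_def rnorm_eq0 v0 rnorm_ge0.
have rvV : `|(rnorm v)^-1| = (rnorm v)^-1 by rewrite ger0_norm // invr_ge0 ltW.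
rewrite -ler_pdivrMr // mulrC -rvV -(@rnormZr _ s) -TZ -lee_fin.
apply: (le_trans _ TC); apply: ereal_sup_ubound.
by exists (of_real (rnorm v)^-1 *: v) => //=; rewrite rnormZr rvV mulVf ?gt_eqF.
Qed.

Lemma fset_argmin A (f : nat -> R) : A != fset0 ->
  exists2 n0, n0 \in A & forall n, n \in A -> f n0 <= f n.
Proof.
case/fset0Pn => k kA.
case: (@arg_minP _ _ _ [` kA]%fset xpredT (fun i : A => f (val i)) isT).
move=> i _ Hi; exists (val i); first exact: valP.
by move=> n nA; have := Hi [` nA]%fset isT.
Qed.

End Constants.

(** * The upper bound, with [K1] and [K2] for finite values of k^c_(2m-1) and nu *)

Section UpperBound.
Context {R : realType} {s : scalars}.
Local Notation K := (scalar_field R s).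
Context {X : completeNormedModType K} {e : nat -> X} {es : nat -> X -> K^o}.
Context (es_linear : forall n, linear (es n)).
Context (es_e : forall i j, es i (e j) = (i == j)%:R).
Local Notation P := (coord_proj e es).
Context {tau K1 K2 : R} {m : nat}.
Context (tau_gt0 : 0 < tau) (m_gt0 : (0 < m)%N).
Context (K1_ge0 : 0 <= K1) (tau_le_K2 : tau <= K2).
Context (K1P : forall (F : {fset nat}) y, (#|` F| <= 2 * m - 1)%N ->
  rnorm (y - P F y) <= K1 * rnorm y).
Context (K2P : forall y (A B : {fset nat}) (eps del : nat -> K),
  (forall n, rnorm (es n y) <= 1 / tau) -> #|` A| = #|` B| -> (#|` A| <= m)%N ->
  disjoint3 es A B y -> sign eps -> sign del ->
  rnorm (y + signed_sum e eps A) != 0 ->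
  rnorm (of_real tau *: y + signed_sum e del B) <=
    K2 * rnorm (y + signed_sum e eps A)).

(** Nonzero coefficients on [L] make the minimum [t] positive, so that the vector can be divided by
    [t] before the A-property is applied. *)
Lemma greedy_upper_bound_neq0 x (L A : {fset nat}) (a : nat -> K) :
  #|` L| = m -> weak_greedy es tau x L -> (forall n, n \in L -> es n x != 0) ->
  (#|` A| <= m)%N ->
  tau * rnorm (x - P L x) <=
    K1 * K2 * rnorm (x - \sum_(n <- A) a n *: e n).
Proof.
move=> Lm /(weak_greedyP _ _ tau_gt0) Lgreedy L0 Am.
set w := \sum_(n <- A) _; set z := x - w.
have K2_gt0 : 0 < K2 by exact: lt_le_trans tau_le_K2.
(* If [A] lies in [L], then [P L] fixes the approximant and the bound on projections suffices, since
   m <= 2m - 1; [tau <= K2] provides the factor [K2]. *)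
have [AL|] := boolP (A `<=` L)%fset.
  have -> : x - P L x = z - P L z.
    by rewrite coord_projB // coord_proj_comb // opprB addrA subrK.
  rewrite [K1 * _]mulrC -mulrA.
  apply: (ler_pM (ltW tau_gt0) (rnorm_ge0 _) tau_le_K2).
  by apply: K1P; rewrite Lm; lia.
move=> AnL; pose B := (A `\` L)%fset; pose U := (L `|` A)%fset.
have U_split : U = (L `|` B)%fset.
  by apply/fsetP => n; rewrite !inE; case: (n \in L).
(* Both differences remove the same intersection, and [A] has at most as many elements as [L]. *)
have B_leq : (#|` B| <= #|` (L `\` A)%fset|)%N.
  rewrite /B !cardfsD [(L `&` A)%fset]fsetIC Lm; exact: leq_sub2r.
have [A1 A1LA A1B] := fsubset_of_card B_leq.
have A1P n : n \in A1 -> (n \in L) && (n \notin A).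
  by move=> /(fsubsetP A1LA); rewrite !inE andbC.
have A1_neq0 : A1 != fset0.
  by rewrite -cardfs_gt0 A1B cardfs_gt0 fsetD_eq0.
pose c n := es n x.
have [n0 n0A1 n0min] := fset_argmin (fun n => rnorm (c n)) A1_neq0.
have /andP[n0L n0A] := A1P _ n0A1.
set t := rnorm (c n0) in n0min.
have t_gt0 : 0 < t by rewrite lt_def rnorm_eq0 rnorm_ge0 andbT L0.
pose x' := x - P U x.
have es_x' n : es n x' = if n \in U then 0 else es n x.
  by rewrite esB // es_coord_proj //; case: ifP; rewrite ?subrr ?subr0.
have off_le k : k \notin L -> rnorm (c k) <= t / tau.
  by move=> kL; rewrite ler_pdivlMr // mulrC Lgreedy.
have truncated :
    rnorm (x' + of_real t *: signed_sum e (sgn \o c) A1) <= K1 * rnorm z.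
  apply: truncation_bound => // [|A2 A21 n0A2]; first exact: L0.
  have A2U : (A2 `<=` U)%fset.
    by apply/fsubsetP => n /(fsubsetP A21)/A1P /andP[nL _]; rewrite !inE nL.
  pose F := (U `\` A2)%fset.
  have AF : (A `<=` F)%fset.
    apply/fsubsetP => n nA; rewrite !inE nA orbT andbT; apply/negP.
    by move=> /(fsubsetP A21)/A1P; rewrite nA andbF.
  (* Since [A] is inside [F], the approximant cancels and z - P_F z = x - P_F x; moreover [U] is the
     disjoint union of [F] and [A2]. *)
  have -> : x' + \sum_(n <- A2) c n *: e n = z - P F z.
    rewrite coord_projB // (coord_proj_comb es_linear es_e _ AF) opprB addrA subrK.
    have -> : x' = x - (P F x + P A2 x).
      rewrite -coord_projU; last by apply/fdisjointP => n; rewrite !inE => /andP[].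
      congr (x - P _ x); apply/fsetP => n; have /fsubsetP/(_ n) := A2U.
      by rewrite !inE; case: (n \in A2) => [->|] //=; rewrite orbF.
    by rewrite opprD addrA subrK.
  (* [U] has at most 2m elements, and [A2] contains at least [n0]: this gives 2m - 1. *)
  apply: K1P; rewrite cardfsDS //; apply: leq_sub.
    by rewrite cardfsU (leq_trans (leq_subr _ _)) // Lm mul2n -addnn leq_add2l.
  by rewrite cardfs_gt0; apply/fset0Pn; exists n0.
(* Outside [U] the coefficients of [x] are at most [t / tau] by weak greediness, so those of [y] are
   at most [1 / tau]. *)
pose y := of_real t^-1 *: x'.
have x'E : x' = of_real t *: y.
  by rewrite scalerA -of_realM mulfV ?gt_eqF // of_real1 scale1r.
have -> : x - P L x = x' + \sum_(n <- B) c n *: e n.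
  rewrite /x' U_split coord_projU ?opprD ?addrA ?subrK //.
  by apply/fdisjointP => n nL; rewrite !inE nL.
rewrite mulrC -ler_pdivlMr //; apply: (@sign_bound _ _ _ _ _ _ (t / tau)).
- exact: divr_gt0.
- by move=> n; rewrite !inE => /andP[nL _]; exact: off_le.
move=> del sdel.
have -> : x' + of_real (t / tau) *: signed_sum e del B =
    of_real (t / tau) *: (of_real tau *: y + signed_sum e del B).
  by rewrite scalerDr scalerA -of_realM mulfVK ?gt_eqF // -x'E.
rewrite rnormZr gtr0_norm ?divr_gt0 // mulrAC ler_pM2r ?invr_gt0 //.
have seps : sign (sgn \o c : nat -> K) by move=> n; exact: norm_sgn.
set d := y + signed_sum e (sgn \o c) A1.
(* The coefficient of [d] at [n0] is unimodular, because [y] vanishes on [U]. *)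
have d_neq0 : rnorm d != 0.
  rewrite rnorm_eq0; apply/eqP => /(congr1 (es n0)).
  rewrite es0 // esD // esZ // es_x' !inE n0L mulr0 add0r es_comb // n0A1.
  by move/eqP; rewrite -normr_eq0 seps oner_eq0.
apply: (@le_trans _ _ (t * (K2 * rnorm d))).
  rewrite ler_pM2l //; apply: K2P => //.
  - move=> n; rewrite esZ // es_x' rnormM rnorm_of_real gtr0_norm ?invr_gt0 //.
    rewrite mulrC ler_pdivrMr // mulrC mulrA mulr1; case: ifPn => [_|].
      by rewrite rnorm0 divr_ge0 // ltW.
    by rewrite !inE negb_or => /andP[nL _]; exact: off_le.
  - by rewrite A1B (leq_trans (fsubset_leq_card (fsubsetDl _ _))).
  - apply/disjoint3P; split.
    + by apply/fdisjointP => n /A1P/andP[nL _]; rewrite !inE nL.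
    + by move=> n /A1P/andP[nL _]; rewrite esZ // es_x' !inE nL mulr0.
    + by move=> n; rewrite !inE => /andP[_ nA];
      rewrite esZ // es_x' !inE nA orbT mulr0.
rewrite [K1 * K2]mulrC mulrCA -[leRHS]mulrA ler_pM2l //.
suff <- : rnorm (x' + of_real t *: signed_sum e (sgn \o c) A1) = t * rnorm d.
  exact: truncated.
by rewrite {1}x'E -scalerDr rnormZr gtr0_norm.
Qed.

(* Enlarging the coefficients on L by eta keeps L weak greedy and makes the
   previous lemma applicable; then eta tends to 0. *)
Lemma greedy_upper_bound x (L A : {fset nat}) (a : nat -> K) :
  #|` L| = m -> weak_greedy es tau x L -> (#|` A| <= m)%N ->
  tau * rnorm (x - P L x) <=
    K1 * K2 * rnorm (x - \sum_(n <- A) a n *: e n).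
Proof.
move=> Lm /(weak_greedyP _ _ tau_gt0) Lgreedy Am.
set z := x - \sum_(n <- A) _; pose v := signed_sum e (sgn \o es^~ x) L.
have K2_ge0 : 0 <= K2 by rewrite (le_trans (ltW tau_gt0)).
have Kv_ge0 : 0 <= K1 * K2 * rnorm v by rewrite !mulr_ge0 ?rnorm_ge0.
apply/ler_addgt0Pr => d d_gt0.
(* The perturbation then costs at most [d]; the summand 1 keeps the denominator positive. *)
pose eta := d / (K1 * K2 * rnorm v + 1).
have eta_gt0 : 0 < eta by rewrite divr_gt0 // ltr_wpDl.
pose xeta := x + of_real eta *: v.
have es_xeta n : es n xeta = if n \in L
    then of_real (rnorm (es n x) + eta) * sgn (es n x) else es n x.
  rewrite esD // esZ // es_comb //; case: ifP => _; last by rewrite mulr0 addr0.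
  by rewrite {1}[es n x]sgnE -mulrDl -of_realD.
have rnorm_xeta n : n \in L -> rnorm (es n xeta) = rnorm (es n x) + eta.
  move=> nL; rewrite es_xeta nL rnormM rnorm_of_real ger0_norm.
    rewrite (@rnorm_sign _ s (fun=> sgn (es n x)) n) ?mulr1 // => ?.
    exact: norm_sgn.
  by rewrite addr_ge0 ?rnorm_ge0 // ltW.
have xeta_greedy : weak_greedy es tau xeta L.
  apply/weak_greedyP => // n k nL kL.
  rewrite (rnorm_xeta n nL) es_xeta (negPf kL) (le_trans (Lgreedy n k nL kL)) //.
  by rewrite lerDl ltW.
have xeta_neq0 n : n \in L -> es n xeta != 0.
  by move=> nL; rewrite -rnorm_eq0 rnorm_xeta // gt_eqF // ltr_wpDl ?rnorm_ge0.
have := greedy_upper_bound_neq0 a Lm xeta_greedy xeta_neq0 Am.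
rewrite coord_projD // coord_projZ // coord_proj_comb // opprD addrACA subrr addr0.
move=> /le_trans; apply.
rewrite (_ : xeta - _ = z + of_real eta *: v); last by rewrite /z addrAC.
apply: (@le_trans _ _ (K1 * K2 * (rnorm z + eta * rnorm v))).
  rewrite ler_wpM2l ?mulr_ge0 // -[in leRHS](gtr0_norm eta_gt0) -(@rnormZr _ s).
  exact: rnormD.
rewrite mulrDr lerD2l mulrCA /eta mulrAC ler_pdivrMr ?ltr_wpDl //.
by rewrite ler_pM2l // lerDl.
Qed.

End UpperBound.

(** * Lower bounds for an arbitrary admissible Lebesgue constant [C] *)

Section LowerBound.
Context {R : realType} {s : scalars}.
Local Notation K := (scalar_field R s).
Context {X : completeNormedModType K} {e : nat -> X} {es : nat -> X -> K^o}.
Context (es_linear : forall n, linear (es n)).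
Context (es_e : forall i j, es i (e j) = (i == j)%:R).
Context {M : R} (M_gt0 : 0 < M).
Context (e_le : forall n, rnorm (e n) <= M).
Context (es_le : forall n x, rnorm (es n x) <= M * rnorm x).
Context (e_dense : closure (lin_span e) = setT).
Local Notation P := (coord_proj e es).
Context {tau C : R} {m : nat}.
Context (tau_gt0 : 0 < tau) (tau_le1 : tau <= 1).
Context (CP : forall x, (gamma e es m tau x <= C%:E * sigma e m x)%E).

Lemma rnorm_le_gamma x (L : {fset nat}) :
  #|` L| = m -> weak_greedy es tau x L ->
  ((rnorm (x - P L x))%:E <= gamma e es m tau x)%E.
Proof. by move=> Lm Lg; apply: ereal_sup_ubound; exists L. Qed.

(** The test vector is the sum of the first m + 1 basis vectors. Any [A] with at most m elements
    misses one of them, so sigma_m is at least [M^-1], and a negative [C] would force gamma to be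
    negative. *)
Lemma lebesgue_ge0 : 0 <= C.
Proof.
pose D := [fset n in iota 0 m.+1]%fset; pose L := [fset n in iota 0 m]%fset.
pose x := \sum_(n <- D) 1 *: e n.
have esx n : es n x = if n \in D then 1 else 0 by exact: es_comb.
have Lgreedy : weak_greedy es tau x L.
  apply/weak_greedyP => // n k nL _.
  have nD : n \in D by move: nL; rewrite !mem_interval => /ltnW.
  rewrite !esx nD rnorm1; case: ifP => _; first by rewrite rnorm1 mulr1.
  by rewrite rnorm0 mulr0.
have sigma_gt0 : (0 < sigma e m x)%E.
  apply: (@lt_le_trans _ _ (M^-1)%:E); first by rewrite lte_fin invr_gt0.
  apply: le_ereal_inf_tmp => _ [A [a [Am ->]]].
  have /fset0Pn[n] : (D `\` A)%fset != fset0.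
    rewrite -cardfs_gt0 cardfsD subn_gt0 card_interval ltnS.
    by apply: leq_trans Am; apply: fsubset_leq_card; exact: fsubsetIr.
  rewrite in_fsetD => /andP[nA nD].
  have := es_le n (x - \sum_(k <- A) a k *: e k).
  rewrite esB // esx nD es_comb // (negPf nA) subr0 rnorm1.
  by rewrite lee_fin -ler_pdivrMl // mulr1.
rewrite leNgt; apply/negP => C_lt0.
have : (0 <= C%:E * sigma e m x)%E.
  apply: le_trans (CP x); apply: le_trans (rnorm_le_gamma _ Lgreedy).
    by rewrite lee_fin rnorm_ge0.
  exact: card_interval.
by rewrite leNgt mule_lt0_gt0.
Qed.

Lemma lebesgue_bound x (L A : {fset nat}) (a : nat -> K) :
  #|` L| = m -> weak_greedy es tau x L -> (#|` A| <= m)%N ->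
  rnorm (x - P L x) <= C * rnorm (x - \sum_(n <- A) a n *: e n).
Proof.
move=> Lm Lgreedy Am; rewrite -lee_fin EFinM.
apply: (le_trans (rnorm_le_gamma Lm Lgreedy)); apply: (le_trans (CP x)).
apply: lee_wpmul2l; first by rewrite lee_fin lebesgue_ge0.
by apply: ereal_inf_lbound; exists A, a.
Qed.

Lemma suppression_le_lebesgue x (A : {fset nat}) : (#|` A| <= m)%N ->
  rnorm (x - P A x) <= C * rnorm x.
Proof.
move=> Am; apply/ler_addgt0Pr => d d_gt0.
have [D [Dm DA PD]] := coord_proj_far es_linear es_e M_gt0 e_le es_le e_dense
  A x (m - #|` A|) d_gt0.
pose L := (D `|` A)%fset.
have Lm : #|` L| = m.
  rewrite /L cardfsU Dm; move: DA => /eqP ->.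
  by rewrite cardfs0 subn0 subnK.
(* Coefficients of [x] are at most [M * rnorm x]; after adding [t], those on [L] are at least that
   large, and [L] is weak greedy. *)
pose t := M * rnorm x + M * rnorm x.
have t_ge0 : 0 <= t by rewrite addr_ge0 // mulr_ge0 ?rnorm_ge0 // ltW.
pose w := \sum_(n <- L) of_real t *: e n.
have Lgreedy : weak_greedy es tau (x + w) L.
  apply/weak_greedyP => // n k nL kL.
  rewrite !esD // !es_comb // nL (negPf kL) addr0.
  apply: (@le_trans _ _ (M * rnorm x)).
    by rewrite (le_trans _ (es_le k x)) // ler_piMl ?rnorm_ge0.
  have := rnormD (es n x + of_real t : K^o) (- es n x).
  rewrite addrC addKr rnormN rnorm_of_real ger0_norm //.
  by have := es_le n x; rewrite /t; lra.
(* Here [w] is itself the approximant of [x + w], leaving [x], while removing [L] leaves x - P_A x -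
   P_D x. *)
have := lebesgue_bound (fun=> of_real t) Lm Lgreedy (eq_leq Lm).
rewrite addrK coord_projD // (coord_proj_comb es_linear es_e) //.
rewrite opprD addrACA subrr addr0 coord_projU // opprD addrCA => H.
have := rnormD (- P D x + (x - P A x)) (P D x).
by rewrite [X in rnorm X <= _]addrC addNKr; lra.
Qed.

Lemma coord_proj_comb0 (A F : {fset nat}) (a : nat -> K) :
  [disjoint F & A]%fset -> P F (\sum_(n <- A) a n *: e n) = 0.
Proof.
move=> /fdisjointP FA; rewrite /coord_proj big_seq big1 // => n nF.
by rewrite es_comb // (negPf (FA n nF)) scale0r.
Qed.

Lemma property_A_le_lebesgue x (A B : {fset nat}) (eps del : nat -> K) :
  (forall n, rnorm (es n x) <= 1 / tau) -> #|` A| = #|` B| -> (#|` A| <= m)%N ->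
  disjoint3 es A B x -> sign eps -> sign del ->
  rnorm (of_real tau *: x + signed_sum e del B) <=
    C * tau * rnorm (x + signed_sum e eps A).
Proof.
move=> x_le AB Am /disjoint3P[dAB xA xB] seps sdel.
have tauV_ge0 : 0 <= tau^-1 by rewrite invr_ge0 ltW.
rewrite [C * tau]mulrC -mulrA -ler_pdivrMl //.
have -> : tau^-1 * rnorm (of_real tau *: x + signed_sum e del B) =
    rnorm (x + of_real tau^-1 *: signed_sum e del B).
  rewrite -{1}(ger0_norm tauV_ge0) -(@rnormZr _ s) scalerDr scalerA -of_realM.
  by rewrite mulVf ?gt_eqF // of_real1 scale1r.
apply/ler_addgt0Pr => d d_gt0.
have [D [Dm DAB PD]] := coord_proj_far es_linear es_e M_gt0 e_le es_le e_dense
  (A `|` B)%fset x (m - #|` A|) d_gt0.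
move: DAB; rewrite fdisjointXU => /andP[DA DB].
pose L := (D `|` A)%fset; pose U := (D `|` B)%fset.
have Lm : #|` L| = m.
  rewrite /L cardfsU Dm; move: DA => /eqP ->.
  by rewrite cardfs0 subn0 subnK.
have Um : (#|` U| <= m)%N.
  rewrite cardfsU; apply: (leq_trans (leq_subr _ _)).
  by rewrite Dm -AB subnK.
(* As the coefficients of [x] are at most [1 / tau], adding [t] brings those on [D] to modulus at
   least 1. *)
pose t := 1 + 1 / tau.
have t_ge0 : 0 <= t by rewrite addr_ge0 // div1r.
pose a n : K := if n \in D then of_real t else of_real tau^-1 * del n.
pose w := \sum_(n <- U) a n *: e n.
have wE : w = \sum_(n <- D) of_real t *: e n + of_real tau^-1 *: signed_sum e del B.
  rewrite /w big_fsetU_disjoint //; congr (_ + _).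
    by apply: eq_big_seq => n nD; rewrite /a nD.
  rewrite scaler_sumr; apply: eq_big_seq => n nB; rewrite /a scalerA ifF //.
  by apply/negP => /(fdisjointP DB); rewrite nB.
pose y := x + signed_sum e eps A + w.
have es_y n : es n y = es n x + (if n \in A then eps n else 0)
    + (if n \in U then a n else 0) by rewrite !esD // !es_comb.
(* The value 1 separates: coefficients on [L] have modulus at least 1, those off [L] at most
   [1 / tau], with equality on [B]. *)
have Lgreedy : weak_greedy es tau y L.
  apply/weak_greedyP => // n k nL kL; apply: (@le_trans _ _ 1).
    move: kL; rewrite inE negb_or => /andP[kD kA].
    rewrite es_y inE (negPf kA) (negPf kD) addr0 /=.
    case: ifP => kB; last first.
      by rewrite addr0 -ler_pdivlMl // mulrC x_le.
    rewrite xB // add0r /a (negPf kD) rnormM rnorm_sign // mulr1 rnorm_of_real.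
    by rewrite ger0_norm // mulfV ?gt_eqF.
  move: nL; rewrite es_y !inE; have [nD _|nD /= nA] := boolP (n \in D).
    rewrite (negPf (fdisjointP DA _ nD)) addr0 /= /a nD.
    have := rnormD (es n x + of_real t : K^o) (- es n x).
    rewrite addrC addKr rnormN rnorm_of_real ger0_norm //.
    by have := x_le n; rewrite /t; lra.
  by rewrite nA xA // add0r (negPf (fdisjointP dAB _ nA)) addr0 rnorm_sign.
(* Subtracting the approximant [w], supported on [U], leaves [x + signed_sum e eps A] on the
   right. *)
have := lebesgue_bound a Lm Lgreedy Um; rewrite -/w addrK.
have -> : y - P L y = x + of_real tau^-1 *: signed_sum e del B - P D x.
  have PLx : P L x = P D x.
    rewrite coord_projU // [X in _ + X](_ : _ = 0) ?addr0 //.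
    by rewrite /coord_proj big_seq big1 // => n nA; rewrite xA // scale0r.
  have PLdel : P L (signed_sum e del B) = 0.
    by apply: coord_proj_comb0; rewrite fdisjointUX DB dAB.
  rewrite /y wE !coord_projD // PLx coord_projZ // PLdel.
  rewrite !(coord_proj_comb es_linear es_e) ?fsubsetUl ?fsubsetUr //.
  rewrite scaler0 addr0 !opprD !addrA.
  set q := _ *: _; set u := signed_sum _ _ _; set v := \sum_(n <- D) _.
  by rewrite (ACl (1*4*5*(2*6)*(3*7))) /= !subrr !addr0.
move=> H; have := rnormD (x + of_real tau^-1 *: signed_sum e del B - P D x) (P D x).
by rewrite subrK; lra.
Qed.

End LowerBound.

(** * Uniform bounds for an M-basis and positivity of the constants *)

Section Mbasis.
Context {R : realType} {s : scalars}.
Local Notation K := (scalar_field R s).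
Context {X : completeNormedModType K} {e : nat -> X} {es : nat -> X -> K^o}.

Lemma Mbasis_bounded : Mbasis e es -> exists M : R, [/\ 0 < M,
  forall n, rnorm (e n) <= M & forall n x, rnorm (es n x) <= M * rnorm x].
Proof.
case=> -[[es_dual es_e] _] [_ + _ _]; set norms := (_ `|` _)%classic.
move=> sup_lt; have es_linear n : linear (es n) by case: (es_dual n).
have e_norms n : norms (rnorm (e n))%:E by left; exists n.
have sup_ge0 : (0 <= ereal_sup norms)%E.
  by apply: le_trans (ereal_sup_ubound (e_norms 0%N)); rewrite lee_fin rnorm_ge0.
have sup_fin : ereal_sup norms \is a fin_num by rewrite ge0_fin_numE.
(* Adding 1 makes [M] strictly positive. *)
pose M := fine (ereal_sup norms) + 1.
have supM : (ereal_sup norms <= M%:E)%E.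
  by rewrite -(fineK sup_fin) lee_fin /M lerDl.
exists M; split.
- by rewrite ltr_wpDl // fine_ge0.
- by move=> n; rewrite -lee_fin (le_trans _ supM) // ereal_sup_ubound.
- move=> n; apply: opnorm_leP => [c v|]; first exact: esZ.
  by apply: le_trans supM; apply: ereal_sup_ubound; right; exists n.
Qed.

Context (es_linear : forall n, linear (es n)).
Context (es_e : forall i j, es i (e j) = (i == j)%:R).

(** The empty set gives the identity, tested on the normalized [e 0]. The resulting positivity
    settles products with +oo in the upper bound. *)
Lemma kc_ge1 m : (1 <= kc e es m)%E.
Proof.
have e0_gt0 : 0 < rnorm (e 0%N).
  rewrite lt_def rnorm_ge0 rnorm_eq0 andbT; apply/eqP => e0.
  have := es_e 0 0; rewrite e0 es0 // => /eqP.
  by rewrite eq_sym oner_eq0.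
pose y := of_real (rnorm (e 0%N))^-1 *: e 0%N.
have y1 : rnorm y = 1 by rewrite rnormZr gtr0_norm ?invr_gt0 // mulVf // gt_eqF.
apply: (@le_trans _ _ (opnorm (fun x : X => x - coord_proj e es fset0 x))).
  apply: ereal_sup_ubound; exists y; first by rewrite /= y1.
  by rewrite /coord_proj big_seq_fset0 subr0 y1.
by apply: ereal_sup_ubound; exists fset0; rewrite //= cardfs0.
Qed.

(** Empty sets and the vector [e 0] give the quotient [tau]; [tau <= 1] makes this vector
    admissible. Besides positivity, this gives the hypothesis [tau <= K2] of the upper bound. *)
Lemma nu_ge (tau : R) m : 0 < tau <= 1 -> (tau%:E <= nu e es m tau)%E.
Proof.
case/andP=> tau_gt0 tau_le1; apply: ereal_sup_ubound.
have one_sign : sign (fun=> 1 : K) by move=> n; rewrite normr1.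
exists (e 0%N), fset0, fset0, (fun=> 1), (fun=> 1); split.
- apply/norm_infty_leP => n; rewrite es_e div1r; apply: (@le_trans _ _ 1).
    by case: eqP => _; rewrite ?rnorm1 ?rnorm0.
  by rewrite invf_ge1.
- by rewrite cardfs0.
- by apply/disjoint3P; split=> //; apply/fdisjointP.
- by [].
rewrite /signed_sum !big_seq_fset0 !addr0 rnormZr gtr0_norm //.
have e0_neq0 : rnorm (e 0%N) != 0.
  rewrite rnorm_eq0; apply/eqP => e0; have := es_e 0 0; rewrite e0 es0 // => /eqP.
  by rewrite eq_sym oner_eq0.
by split=> //; rewrite mulfK.
Qed.

End Mbasis.

Theorem theorem1p1 (R : realType) (s : scalars)
    (X : completeNormedModType (scalar_field R s))
    (e : nat -> X) (es : nat -> X -> (scalar_field R s)^o)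
    (tau : R) (m : nat) :
  infinite_dimensional X ->
  Mbasis e es ->
  0 < tau <= 1 ->
  (0 < m)%N ->
  (maxe (maxe (kc e es m) (lebesgue_tilde e es m tau))
        (nu e es m tau * (tau^-1)%:E)
     <= lebesgue e es m tau)%E /\
  (lebesgue e es m tau
     <= kc e es (2 * m - 1) * nu e es m tau * (tau^-1)%:E)%E.
Proof.
move=> _ basis tau01 m_gt0; have /andP[tau_gt0 tau_le1] := tau01.
have [M [M_gt0 e_le es_le]] := Mbasis_bounded basis.
have [[[es_dual es_e] _] _ e_dense _] := basis.
have es_linear n : linear (es n) by case: (es_dual n).
have tauV_gt0 : 0 < tau^-1 by rewrite invr_gt0.
split.
  (* It suffices to bound the maximum by each admissible real [C]; if there is none, the infimum is
     +oo. *)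
  apply: le_ereal_inf_tmp => _ [C /= CP <-].
  have C_ge0 := lebesgue_ge0 es_linear es_e M_gt0 es_le tau_gt0 tau_le1 CP.
  rewrite !ge_max lee_pdivrMr //; apply/andP; split; [apply/andP; split|].
  - apply: ge_ereal_sup => _ [A /= Am <-].
    apply: ge_ereal_sup => _ [x /= x1 <-]; rewrite lee_fin.
    have := suppression_le_lebesgue es_linear es_e M_gt0 e_le es_le e_dense
      tau_gt0 tau_le1 CP x Am.
    by move=> /le_trans; apply; rewrite ler_piMr.
  (* A projection on m indices is an m-term combination, so sigma_m is at most its tilde version and
     [C] is admissible there too. *)
  - apply: ereal_inf_lbound; exists C => //= x; apply: (le_trans (CP x)).
    apply: lee_wpmul2l; first by rewrite lee_fin.
    apply: le_ereal_inf_tmp => _ [A /= Am <-]; apply: ereal_inf_lbound.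
    by exists A, (es^~ x); rewrite Am.
  - apply: ge_ereal_sup => q [x [A [B [eps [del]]]]].
    case=> [/norm_infty_leP x_le [AB Am] dAB [seps sdel] [nz ->]].
    rewrite -EFinM lee_fin ler_pdivrMr ?lt_def ?nz ?rnorm_ge0 //.
    exact: (property_A_le_lebesgue es_linear es_e M_gt0 e_le es_le e_dense
      tau_gt0 tau_le1 CP).
have kc1 := kc_ge1 es_linear es_e (2 * m - 1).
have nu1 := nu_ge es_linear es_e m tau01.
have kc0 : (0 < kc e es (2 * m - 1))%E by apply: lt_le_trans kc1; rewrite lte_fin.
have nu0 : (0 < nu e es m tau)%E by apply: lt_le_trans nu1; rewrite lte_fin.
(* If either constant is infinite, positivity of the other factors makes the right-hand side +oo. *)
case kcE : (kc e es (2 * m - 1)) kc0 kc1 => [k1| |] kc0 kc1 //; last first.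
  by rewrite gt0_mulye // gt0_mulye ?lte_fin // leey.
case nuE : (nu e es m tau) nu0 nu1 => [k2| |] nu0 nu1 //; last first.
  by rewrite gt0_muley // gt0_mulye ?lte_fin // leey.
rewrite -!EFinM; apply: ereal_inf_lbound; exists (k1 * k2 / tau) => //= x.
rewrite !lte_fin in kc0 nu0; rewrite lee_fin in nu1.
apply: ge_ereal_sup => _ [L /= [Lm Lgreedy] <-].
have K_gt0 : 0 < k1 * k2 / tau by rewrite divr_gt0 // mulr_gt0.
rewrite -lee_pdivrMl //; apply: le_ereal_inf_tmp => _ [A [a [Am ->]]].
rewrite lee_fin ler_pdivrMl // mulrAC ler_pdivlMr // mulrC.
apply: (greedy_upper_bound es_linear es_e tau_gt0 m_gt0 (ltW kc0) nu1 _ _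
  a Lm Lgreedy Am) => [F y Fm|y B D eps del y_le BD Bm dBD seps sdel nz].
  apply: (@opnorm_leP _ _ _ _ (fun y => y - coord_proj e es F y)).
    by move=> c v; rewrite coord_projZ // scalerBr.
  by rewrite -kcE; apply: ereal_sup_ubound; exists F.
rewrite -ler_pdivrMr ?lt_def ?nz ?rnorm_ge0 // -lee_fin -nuE.
apply: ereal_sup_ubound; exists y, B, D, eps, del; split=> //.
exact/norm_infty_leP.
Qed.
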